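(* For every $c \in (0,1/2]$ there is a constant $C_c>0$, depending only on $c$, such that the following holds. Let $p \geq 3$ be a prime number and let $A \subset \mathbb{Z}/p\mathbb{Z}$ satisfy $c \leq |A|/p \leq 1-c$. Then $$\|\chi_A\|_{A(\mathbb{Z}/p\mathbb{Z})} \geq C_c \left(\frac{\log p}{(\log\log p)^3}\right)^{1/2}.$$
   Context: Here $\chi_A$ is the indicator function of $A$. For $G=\mathbb{Z}/p\mathbb{Z}$, let $\widehat{G}$ be the group of homomorphisms $\gamma:G\to S^1=\{z\in\mathbb{C}:|z|=1\}$. For $f:G\to\mathbb{C}$ put $\widehat{f}(\gamma)=\frac1p\sum_{x\in G} f(x)\overline{\gamma(x)}$ and $\|f\|_{A(G)}:=\|\widehat f\|_1=\sum_{\gamma\in\widehat{G}}|\widehat f(\gamma)|$. *)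

(* Defs.v *)
From HB Require Import structures.
From mathcomp Require Import all_boot all_order all_algebra.
From mathcomp Require Import all_classical all_reals all_analysis.
From mathcomp Require Import complex.

Set Implicit Arguments.
Unset Strict Implicit.
Unset Printing Implicit Defensive.

Import Order.TTheory GRing.Theory Num.Theory.

Local Open Scope classical_set_scope.
Local Open Scope complex_scope.
Local Open Scope ring_scope.

(* Throughout, Z/pZ is the library's 'Z_p, which has p elements only when
   1 < p. *)

(* Real-valued modulus of a complex number; the generic norm `|z| on R[i]
   takes its values in R[i]. *)
Notation cabs := ComplexField.Normc.normc.

Definition dual_group (R : realType) (p : nat) : set ('Z_p -> R[i]) :=
  [set g | (forall x, cabs (g x) = 1) /\ {morph g : x y / x + y >-> x * y}].

Arguments dual_group : clear implicits.

Definition fourier (R : realType) (p : nat) (f g : 'Z_p -> R[i]) : R[i] :=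
  p%:R^-1 * \sum_(x : 'Z_p) f x * (g x)^*%C.

(* A finitely supported sum \sum_(g \in P) has the junk value 0 when infinitely
   many terms are nonzero; finite_dual_group below rules this out. *)
Definition A_norm (R : realType) (p : nat) (f : 'Z_p -> R[i]) : R :=
  \sum_(g \in dual_group R p) cabs (fourier f g).

Definition chi (R : realType) (p : nat) (A : {set 'Z_p}) : 'Z_p -> R[i] :=
  fun x => (x \in A)%:R.

Lemma finite_dual_group (R : realType) (p : nat) :
  finite_set (dual_group R p).
Proof.
pose N := (Zp_trunc p).+2.
have gX g : dual_group R p g -> forall n, g (n%:R) = g 1 ^+ n.
  move=> [g1 gD]; have g0 : g 0 = 1.
    have: g 0 * g 0 = g 0 * 1 by rewrite -gD addr0 mulr1.
    apply: mulfI; apply/eqP => g00; have := g1 0.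
    by rewrite g00 ComplexField.Normc.normc0 => /eqP; rewrite eq_sym oner_eq0.
  by elim=> [|n IH]; rewrite ?expr0 // -natr1 gD IH exprSr.
have [rs rsE] := closed_field_poly_normal ('X^N - 1 : {poly R[i]}).
have inj : {in dual_group R p &, injective (fun g : 'Z_p -> R[i] => g 1)}.
  move=> g h /set_mem /gX gE /set_mem /gX hE gh; apply/funext => x.
  by rewrite -(natr_Zp x) gE hE gh.
have sub : [set g 1 | g in dual_group R p] `<=` [set` rs].
  move=> _ [g /gX gE <-] /=.
  have N0 : (N%:R : 'Z_p) = 0 by rewrite Zp_nat; apply/val_inj; rewrite /= modnn.
  have : root ('X^N - 1 : {poly R[i]}) (g 1).
    rewrite rootE !hornerE -gE N0.
    by have := gE 0%N; rewrite expr0 => ->; rewrite subrr.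
  rewrite rsE rootZ ?root_prod_XsubC //.
  by rewrite lead_coef_eq0 -size_poly_gt0 size_XnsubC.
by rewrite -(eq_finite_set (inj_card_eq inj)); apply: sub_finite_set sub (finite_seq _).
Qed.

(* Main.v *)
Require Import Defs.
From mathcomp Require Import all_boot all_order all_algebra.
From mathcomp Require Import all_classical all_reals all_analysis.
From mathcomp Require Import complex zify ring lra.

Import Order.TTheory GRing.Theory Num.Theory.
Import numFieldNormedType.Exports.
Local Open Scope classical_set_scope.
Local Open Scope ring_scope.

Set Implicit Arguments.
Unset Strict Implicit.

(** Write f for the indicator function of A, a for its density, M for its
    A(Z/p)-norm and cos_r(y) for cos (2 pi r y / p).  The proof gives
    log p <= C M^2 log (C M) with C depending on c only, from which the stated
    bound follows (log_bound_inversion).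

    The idea is to build a probability measure of Riesz-product type,
    proportional to exp (cos_r1 + ... + cos_rk), against which f is locally
    almost constant.  Such measures satisfy Ginibre's correlation inequality
    (ginibre, ginibre_expR): cos_a has nonnegative covariance with cos_r and
    even with every power series in cos_r with nonnegative coefficients.
    Consider the potential sum_a |f^(a)| E(cos_a), which lies in [-M, M].
    Adding a frequency r to the list tilts the measure by exp (cos_r) and, by
    Ginibre, raises the potential by at least
    e^-1 sum_a |f^(a)| Cov(cos_a, cos_r); no term of this sum can cancel
    another.  Hence after k = O(M^2) steps there is a list for which all these
    sums are at most a small multiple of 1/M (exists_saturated).

    Around a point x consider the symmetrised function
    h_x(y) = (f(x+y) + f(x-y)) / 2.  It is a combination of the cos_r with
    coefficients of size at most |f^(r)|, so for a saturated measure its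
    variance is small, for every x (saturated_cov).  As h_x takes values in
    {0, 1/2, 1}, its mean v(x), which is the local density of A at x, is close to
    one of 0, 1/2, 1 (near_half_integer).  If p exceeds (CM)^(Ck), the
    pigeonhole principle gives a nonzero t that almost fixes all of
    cos_r1, ..., cos_rk, so that v(x+t) is close to v(x)
    (exists_almost_period, norm_avg_shift).  The multiples of t exhaust Z/p,
    hence v stays close to a single constant, and so the mean square of v is
    about a^2.  On the other hand the measure is positive definite, so the
    average of f(x+y) f(x-y) over x and y is at least a^2
    (sum_weight_reflect_ge0) and the variances of the h_x have mean at least about
    (a + a^2)/2 - a^2 = a(1-a)/2 (sum_var_ge).  This is not small, a
    contradiction (density_saturated).  Therefore log p = O(k log (C M)). *)

(** * Multipliers of positive semidefinite kernels *)

Definition psd (R : realType) (T : finType) (K : T -> T -> R) : Prop :=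
  forall g : T -> R, 0 <= \sum_u \sum_v K u v * (g u * g v).

(** For symmetric kernels this is, by the Schur product theorem, the same as being
    positive semidefinite.  Taking stability under entrywise products as the
    definition makes closure under products immediate and reduces all uses to
    rank-one kernels, sums and limits, without factorising kernels. *)
Definition psd_mult (R : realType) (T : finType) (K : T -> T -> R) : Prop :=
  forall L : T -> T -> R, psd L -> psd (fun u v => K u v * L u v).

Lemma psd_mult_psd (R : realType) (T : finType) (K : T -> T -> R) :
  psd_mult K -> psd K.
Proof.
move=> KM g; have one_psd : psd (fun _ _ : T => 1 : R).
  move=> h; rewrite (_ : \sum_u _ = (\sum_u h u) ^+ 2) ?sqr_ge0//.
  rewrite expr2 big_distrlr /=.
  by apply: eq_bigr => u _; apply: eq_bigr => v _; rewrite mul1r.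
have := KM _ one_psd g; congr (_ <= _).
by apply: eq_bigr => u _; apply: eq_bigr => v _; rewrite mulr1.
Qed.

Lemma eq_psd_mult (R : realType) (T : finType) (K L : T -> T -> R) :
  (forall u v, K u v = L u v) -> psd_mult K -> psd_mult L.
Proof.
by move=> KL; rewrite (_ : K = L)//; apply/funext => u; apply/funext => v.
Qed.

(** The factor F u * F v is absorbed into the test function. *)
Lemma psd_mult_rank1 (R : realType) (T : finType) (F : T -> R) :
  psd_mult (fun u v => F u * F v).
Proof.
move=> L Lp g; have := Lp (fun u => F u * g u); congr (_ <= _).
by apply: eq_bigr => u _; apply: eq_bigr => v _; ring.
Qed.

Lemma psd_multZ (R : realType) (T : finType) (a : R) (K : T -> T -> R) :
  0 <= a -> psd_mult K -> psd_mult (fun u v => a * K u v).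
Proof.
move=> a0 KM L Lp g; have := mulr_ge0 a0 (KM _ Lp g); congr (_ <= _).
rewrite mulr_sumr; apply: eq_bigr => u _.
by rewrite mulr_sumr; apply: eq_bigr => v _; rewrite !mulrA.
Qed.

Lemma psd_multD (R : realType) (T : finType) (K K' : T -> T -> R) :
  psd_mult K -> psd_mult K' -> psd_mult (fun u v => K u v + K' u v).
Proof.
move=> KM KM' L Lp g; have := addr_ge0 (KM _ Lp g) (KM' _ Lp g).
congr (_ <= _); rewrite -big_split/=; apply: eq_bigr => u _.
by rewrite -big_split/=; apply: eq_bigr => v _; rewrite !mulrDl.
Qed.

Lemma psd_multM (R : realType) (T : finType) (K K' : T -> T -> R) :
  psd_mult K -> psd_mult K' -> psd_mult (fun u v => K u v * K' u v).
Proof.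
move=> KM KM' L Lp g; have := KM _ (KM' _ Lp) g; congr (_ <= _).
by apply: eq_bigr => u _; apply: eq_bigr => v _; rewrite !mulrA.
Qed.

Lemma psd_mult_cst (R : realType) (T : finType) (a : R) :
  0 <= a -> psd_mult (fun _ _ : T => a).
Proof.
move=> a0; apply: eq_psd_mult (psd_multZ a0 (psd_mult_rank1 (fun=> 1))).
by move=> u v; rewrite !mulr1.
Qed.

Lemma psd_mult_sum (R : realType) (T : finType) (I : Type) (s : seq I)
    (K : I -> T -> T -> R) :
  (forall i, psd_mult (K i)) -> psd_mult (fun u v => \sum_(i <- s) K i u v).
Proof.
move=> KM; elim: s => [|i s IH].
  by apply: eq_psd_mult (@psd_mult_cst R T 0 (lexx 0)) => u v; rewrite big_nil.
by apply: eq_psd_mult (psd_multD (KM i) IH) => u v; rewrite big_cons.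
Qed.

Lemma psd_mult_lim (R : realType) (T : finType)
    (K_ : nat -> T -> T -> R) (K : T -> T -> R) :
  (forall n, psd_mult (K_ n)) ->
  (forall u v, K_ n u v @[n --> \oo] --> K u v) -> psd_mult K.
Proof.
move=> KM Kcvg L Lp g.
have sum_cvg : (\sum_u \sum_v K_ n u v * L u v * (g u * g v)) @[n --> \oo] -->
    \sum_u \sum_v K u v * L u v * (g u * g v).
  apply: cvg_big => [|u _]; first exact: add_continuous.
  apply: cvg_big => [|v _]; first exact: add_continuous.
  by apply: cvgMr_tmp; apply: cvgMr_tmp; exact: Kcvg.
by apply: (cvgr_to_ge sum_cvg); apply: nearW => n; exact: KM.
Qed.

Lemma cvg_series_exp_coeff (R : realType) (x : R) :
  series (exp_coeff x) n @[n --> \oo] --> expR x.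
Proof. exact: is_cvg_series_exp_coeff. Qed.

Lemma psd_multX (R : realType) (T : finType) (K : T -> T -> R) n :
  psd_mult K -> psd_mult (fun u v => K u v ^+ n).
Proof.
move=> KM; elim: n => [|n IH]; first exact: psd_mult_cst.
by apply: eq_psd_mult (psd_multM KM IH) => u v; rewrite exprS.
Qed.

Lemma psd_mult_expR (R : realType) (T : finType) (K : T -> T -> R) :
  psd_mult K -> psd_mult (fun u v => expR (K u v)).
Proof.
move=> KM; apply: (@psd_mult_lim _ _ (fun n u v => series (exp_coeff (K u v)) n)).
  elim=> [|n IH].
    apply: eq_psd_mult (@psd_mult_cst R T 0 (lexx 0)) => u v.
    by rewrite /series/= big_geq.
  have := psd_multD IH (psd_multZ (a := n`!%:R^-1) _ (psd_multX n KM)).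
  rewrite invr_ge0 ler0n => /(_ isT); apply: eq_psd_mult => u v.
  by rewrite /series/= big_nat_recr//= /exp_coeff/= mulrC.
by move=> u v; exact: cvg_series_exp_coeff.
Qed.

(** With s = d + c and e = d - c, both d^n + c^n and d^n - c^n are polynomials in
    s and e with nonnegative coefficients; the two statements have to be proved
    together by induction. *)
Lemma psd_mult_subX (R : realType) (T : finType) (c d : T -> T -> R) (n : nat) :
  psd_mult (fun u v => d u v + c u v) -> psd_mult (fun u v => d u v - c u v) ->
  psd_mult (fun u v => d u v ^+ n + c u v ^+ n) /\
  psd_mult (fun u v => d u v ^+ n - c u v ^+ n).
Proof.
move=> sM dM; elim: n => [|n [IHs IHd]].
  split; first exact: (psd_mult_cst (a := 1 + 1)).
  by apply: eq_psd_mult (@psd_mult_cst R T 0 (lexx 0)) => u v; rewrite subrr.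
have half0 : 0 <= 2^-1 :> R by rewrite invr_ge0.
split.
- apply: eq_psd_mult (psd_multZ half0 (psd_multD (psd_multM sM IHs) (psd_multM dM IHd))).
  by move=> u v; rewrite !exprS; field.
- apply: eq_psd_mult (psd_multZ half0 (psd_multD (psd_multM sM IHd) (psd_multM dM IHs))).
  by move=> u v; rewrite !exprS; field.
Qed.

(** The function exp x - x has a power series with nonnegative coefficients,
    so its increment from c to d is a nonnegative combination of the d^n - c^n. *)
Lemma psd_mult_subexpR (R : realType) (T : finType) (c d : T -> T -> R) :
  psd_mult (fun u v => d u v + c u v) -> psd_mult (fun u v => d u v - c u v) ->
  psd_mult (fun u v => (expR (d u v) - d u v) - (expR (c u v) - c u v)).
Proof.
(* The partial sums start with the two terms 1 + x, so that subtracting x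
   leaves nonnegative coefficients in each of them. *)
move=> sM dM; pose tail (x : R) n := series (exp_coeff x) (n + 2)%N - x.
apply: (@psd_mult_lim _ _ (fun n u v => tail (d u v) n - tail (c u v) n)).
  elim=> [|n IH].
    apply: eq_psd_mult (@psd_mult_cst R T 0 (lexx 0)) => u v.
    rewrite /tail /series/= !big_nat_recr//= !big_geq//=.
    by rewrite /exp_coeff/= !fact0 !factS !fact0; field.
  have f0 : 0 <= ((n + 2)`!%:R)^-1 :> R by rewrite invr_ge0.
  apply: eq_psd_mult (psd_multD IH (psd_multZ f0 (psd_mult_subX (n + 2) sM dM).2)).
  move=> u v; rewrite /tail /series/= !(addSn n) !big_nat_recr//= /exp_coeff/=.
  by ring.
move=> u v; apply: cvgB; (apply: cvgB; last exact: cvg_cst);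
  by rewrite (cvg_shiftn 2 (series _)); exact: cvg_series_exp_coeff.
Qed.

(** * Trigonometry on Z/p *)

Section Trig.
Variables (R : realType) (p : nat).
Notation G := 'Z_p.
Notation N := (Zp_trunc p).+2.

Definition zangle (k : G) : R := 2 * pi * (k%:R / N%:R).
Definition zcos (k : G) : R := cos (zangle k).
Definition zsin (k : G) : R := sin (zangle k).

Lemma zangleD_mod (k l : G) :
  exists b : bool, zangle k + zangle l = zangle (k + l) + pi *+ 2 *+ b.
Proof.
exists (N <= k + l)%N; rewrite /zangle /=.
have N0 : N%:R != 0 :> R by rewrite pnatr_eq0.
have := ltn_ord k; have := ltn_ord l; rewrite -/N => lN kN.
have [klN|klN] := leqP N (k + l)%N.
  have -> : ((k + l) %% N)%N = (k + l - N)%N.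
    by rewrite -{1}(subnK klN) modnDr modn_small//; lia.
  by rewrite natrB// natrD mulr1n -mulr_natl; field.
by rewrite modn_small// natrD mulr0n; field.
Qed.

Lemma zcosD k l : zcos (k + l) = zcos k * zcos l - zsin k * zsin l.
Proof.
rewrite /zcos /zsin -cosD; have [[] ->] := zangleD_mod k l; rewrite ?mulr0n ?addr0//.
by rewrite mulr1n cosD2pi.
Qed.

Lemma zsinD k l : zsin (k + l) = zsin k * zcos l + zcos k * zsin l.
Proof.
rewrite /zcos /zsin -sinD; have [[] ->] := zangleD_mod k l; rewrite ?mulr0n ?addr0//.
by rewrite mulr1n sinD2pi.
Qed.

Lemma zcos0 : zcos 0 = 1. Proof. by rewrite /zcos /zangle mul0r mulr0 cos0. Qed.
Lemma zsin0 : zsin 0 = 0. Proof. by rewrite /zsin /zangle mul0r mulr0 sin0. Qed.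

Lemma zcos2Dzsin2 k : zcos k ^+ 2 + zsin k ^+ 2 = 1.
Proof. exact: cos2Dsin2. Qed.

Lemma zcosN k : zcos (- k) = zcos k.
Proof.
have := zcosD (- k) k; have := zsinD (- k) k; rewrite addNr zcos0 zsin0 => s0 c1.
transitivity (zcos (- k) * (zcos k ^+ 2 + zsin k ^+ 2)).
  by rewrite zcos2Dzsin2 mulr1.
transitivity (zcos k * (zcos (- k) * zcos k - zsin (- k) * zsin k) +
              zsin k * (zsin (- k) * zcos k + zcos (- k) * zsin k)); first by ring.
by rewrite -c1 -s0 mulr1 mulr0 addr0.
Qed.

Lemma zsinN k : zsin (- k) = - zsin k.
Proof.
have := zcosD (- k) k; have := zsinD (- k) k; rewrite addNr zcos0 zsin0 => s0 c1.
transitivity (zsin (- k) * (zcos k ^+ 2 + zsin k ^+ 2)).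
  by rewrite zcos2Dzsin2 mulr1.
transitivity (zcos k * (zsin (- k) * zcos k + zcos (- k) * zsin k) -
              zsin k * (zcos (- k) * zcos k - zsin (- k) * zsin k)); first by ring.
by rewrite -c1 -s0 mulr1 mulr0 sub0r.
Qed.

Lemma zcosB k l : zcos (k - l) = zcos k * zcos l + zsin k * zsin l.
Proof. by rewrite zcosD zcosN zsinN mulrN opprK. Qed.

Lemma zcos_max k : `|zcos k| <= 1. Proof. exact: cos_max. Qed.
Lemma zcos_le1 k : zcos k <= 1. Proof. exact: cos_le1. Qed.
Lemma zcos_geN1 k : -1 <= zcos k. Proof. exact: cos_geN1. Qed.
Lemma zsin_max k : `|zsin k| <= 1. Proof. exact: sin_max. Qed.

Lemma zcos_neq1 k : k != 0 -> zcos k != 1.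
Proof.
move=> k0; rewrite /zcos (_ : zangle k = (pi * (k%:R / N%:R)) *+ 2); last first.
  by rewrite /zangle -[RHS]mulr_natl mulrA.
rewrite cos_mulr2n cos2sin2; set s := sin _.
have s0 : 0 < s.
  have kpos : 0 < k%:R :> R by rewrite ltr0n lt0n.
  apply: sin_gt0_pi; rewrite !mulr_gt0 ?pi_gt0 ?invr_gt0//=.
  by rewrite gtr_pMr ?pi_gt0// ltr_pdivrMr// mul1r ltr_nat ltn_ord.
by apply/eqP; nra.
Qed.

(** Translating r by 1 multiplies the sum by cos z, because the corresponding
    sum of sines vanishes by oddness. *)
Lemma sum_zcos (z : G) : \sum_(r : G) zcos (r * z) = (N * (z == 0))%:R.
Proof.
have [->|z0] := eqVneq z 0.
  rewrite (eq_bigr (fun=> 1)); last by move=> r _; rewrite mulr0 zcos0.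
  by rewrite sumr_const card_ord muln1.
rewrite muln0; set S := \sum_r _.
have sin_sum0 : \sum_(r : G) zsin (r * z) = 0.
  have : \sum_(r : G) zsin (r * z) = - \sum_(r : G) zsin (r * z).
    rewrite {1}(reindex_inj (@oppr_inj G)) -sumrN.
    by apply: eq_bigr => r _; rewrite mulNr zsinN.
  by lra.
have : S = S * zcos z.
  rewrite {1}/S (reindex_inj (addIr (1 : G))) mulr_suml.
  rewrite (eq_bigr (fun r => zcos (r * z) * zcos z - zsin (r * z) * zsin z)).
    by rewrite sumrB -[X in _ - X]mulr_suml sin_sum0 mul0r subr0.
  by move=> r _; rewrite mulrDl mul1r zcosD.
move/eqP; rewrite -subr_eq0 -{1}(mulr1 S) -mulrBr mulf_eq0 subr_eq0 => /orP[/eqP//|].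
by rewrite eq_sym (negPf (zcos_neq1 z0)).
Qed.

End Trig.

(** * Weighted averages and covariances *)

Section Average.
Variables (R : realType) (T : finType) (w : T -> R).

Definition avg (F : T -> R) : R := (\sum_y w y * F y) / \sum_y w y.

Definition cov (F H : T -> R) : R :=
  avg (fun y => F y * H y) - avg F * avg H.

Lemma eq_avg F H : F =1 H -> avg F = avg H.
Proof. by move=> /funext ->. Qed.

Lemma avgZ a F : avg (fun y => a * F y) = a * avg F.
Proof.
rewrite /avg mulrA mulr_sumr; congr (_ / _).
by apply: eq_bigr => y _; rewrite mulrCA.
Qed.

Lemma avg_sum (I : finType) (F : I -> T -> R) :
  avg (fun y => \sum_i F i y) = \sum_i avg (F i).
Proof.
rewrite /avg -mulr_suml exchange_big/=; congr (_ / _).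
by apply: eq_bigr => y _; rewrite mulr_sumr.
Qed.

Lemma covC F H : cov F H = cov H F.
Proof.
by rewrite /cov [avg F * _]mulrC; congr (_ - _); apply: eq_avg => y; rewrite mulrC.
Qed.

Lemma cov_sumr (I : finType) (a : I -> R) F (H : I -> T -> R) :
  cov F (fun y => \sum_i a i * H i y) = \sum_i a i * cov F (H i).
Proof.
rewrite /cov (eq_avg (H := fun y => \sum_i a i * (F y * H i y))); last first.
  by move=> y; rewrite mulr_sumr; apply: eq_bigr => i _; rewrite mulrCA.
rewrite !avg_sum mulr_sumr -sumrB; apply: eq_bigr => i _.
by rewrite !avgZ mulrBr [avg F * _]mulrCA.
Qed.

Lemma avgB F H : avg (fun y => F y - H y) = avg F - avg H.
Proof.
rewrite /avg -mulrBl -sumrB; congr (_ / _).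
by apply: eq_bigr => y _; rewrite mulrBr.
Qed.

Lemma covBr F H K : cov F (fun y => H y - K y) = cov F H - cov F K.
Proof.
rewrite /cov (eq_avg (H := fun y => F y * H y - F y * K y)).
  by rewrite !avgB; ring.
by move=> y; rewrite mulrBr.
Qed.

Hypothesis w_gt0 : 0 < \sum_y w y.

Lemma avg_cst a : avg (fun=> a) = a.
Proof. by rewrite /avg -mulr_suml mulrAC divff ?mul1r// gt_eqF. Qed.

(** Writing a covariance in terms of two independent copies is what turns
    correlation inequalities into positivity of a double sum. *)
Lemma cov_pairs F H :
  cov F H * (2 * (\sum_y w y) ^+ 2) =
  \sum_y \sum_z w y * w z * ((F y - F z) * (H y - H z)).
Proof.
set W := \sum_y w y; have W0 : W != 0 by rewrite gt_eqF.
transitivity (2 * (W * (\sum_y w y * (F y * H y)) -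
                   (\sum_y w y * F y) * (\sum_y w y * H y))).
  by rewrite /cov /avg -/W; field.
have swap (a b : T -> R) : \sum_y \sum_z (w y * a y) * (w z * b z) =
    (\sum_y w y * a y) * (\sum_y w y * b y) by rewrite big_distrlr.
have WE : W = \sum_y w y * 1 by apply: eq_bigr => y _; rewrite mulr1.
rewrite [RHS](eq_bigr (fun y => \sum_z
    ((w y * 1) * (w z * (F z * H z)) + (w y * (F y * H y)) * (w z * 1) -
     ((w y * F y) * (w z * H z) + (w y * H y) * (w z * F z))))); last first.
  by move=> y _; apply: eq_bigr => z _; ring.
under [RHS]eq_bigr do rewrite sumrB !big_split/=.
by rewrite sumrB !big_split/= !swap -WE; ring.
Qed.

Hypothesis w_ge0 : forall y, 0 <= w y.

Lemma le_avg F H : (forall y, F y <= H y) -> avg F <= avg H.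
Proof.
move=> FH; rewrite /avg ler_pM2r ?invr_gt0//.
by apply: ler_sum => y _; exact: ler_wpM2l.
Qed.

Lemma norm_avg_le1 F : (forall y, `|F y| <= 1) -> `|avg F| <= 1.
Proof.
move=> F1; rewrite ler_norml -{1}(avg_cst (-1)) -{2}(avg_cst 1).
by apply/andP; split; apply: le_avg => y; have := F1 y; rewrite ler_norml => /andP[].
Qed.

End Average.

(** * Ginibre's inequality and saturated lists of frequencies *)

Section Ginibre.
Variables (R : realType) (p : nat).
Notation G := 'Z_p.

Definition cos_char (r y : G) : R := zcos R (r * y).

Definition weight (s : seq G) (y : G) : R := expR (\sum_(r <- s) cos_char r y).

Lemma weight_gt0 s y : 0 < weight s y. Proof. exact: expR_gt0. Qed.

Lemma sum_weight_gt0 s : 0 < \sum_y weight s y.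
Proof.
rewrite (bigD1 (0 : G))//= ltr_pwDl ?weight_gt0//.
by apply: sumr_ge0 => y _; rewrite ltW ?weight_gt0.
Qed.

Lemma weight_cons r s y : weight (r :: s) y = expR (cos_char r y) * weight s y.
Proof. by rewrite /weight big_cons expRD. Qed.

Lemma psd_mult_zcosB (h : G -> G) r :
  psd_mult (fun u v : G => cos_char r (h u - h v)).
Proof.
apply: eq_psd_mult (psd_multD (psd_mult_rank1 (fun u => zcos R (r * h u)))
                              (psd_mult_rank1 (fun u => zsin R (r * h u)))) => u v.
by rewrite /cos_char mulrBr zcosB.
Qed.

(** In the rotated variables u, v the sum and the difference of
    cos (r (u - v)) and cos (r (u + v)) are 2 cos (r u) cos (r v) and
    2 sin (r u) sin (r v), which are of rank one.  This is the trigonometric fact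
    behind Ginibre's inequality. *)
Lemma psd_mult_zcos_add r :
  psd_mult (fun u v : G => cos_char r (u - v) + cos_char r (u + v)).
Proof.
apply: eq_psd_mult (psd_multZ (ler0n R 2) (psd_mult_rank1 (fun u => zcos R (r * u)))).
by move=> u v; rewrite /cos_char mulrBr mulrDr zcosB zcosD; ring.
Qed.

Lemma psd_mult_zcos_sub r :
  psd_mult (fun u v : G => cos_char r (u - v) - cos_char r (u + v)).
Proof.
apply: eq_psd_mult (psd_multZ (ler0n R 2) (psd_mult_rank1 (fun u => zsin R (r * u)))).
by move=> u v; rewrite /cos_char mulrBr mulrDr zcosB zcosD; ring.
Qed.

Lemma psd_weightB s (h : G -> G) : psd (fun u v => weight s (h u - h v)).
Proof.
apply/psd_mult_psd/psd_mult_expR/psd_mult_sum => r; exact: psd_mult_zcosB.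
Qed.

Hypothesis double_inj : injective (fun x : G => x + x).

Lemma sum_rotate (F : G -> G -> R) :
  \sum_y \sum_z F y z = \sum_u \sum_v F (u - v) (u + v).
Proof.
rewrite pair_bigA/= [RHS]pair_bigA/=.
rewrite (reindex_inj (h := fun a : G * G => (a.1 - a.2, a.1 + a.2)))//.
move=> [u v] [u' v'] e.
have uv1 : u - v = u' - v' := congr1 fst e.
have uv2 : u + v = u' + v' := congr1 snd e.
have uE : u = u'.
  apply: double_inj => /=.
  have -> : u + u = (u - v) + (u + v) by ring.
  by rewrite uv1 uv2; ring.
by move: uv2; rewrite uE => /addrI ->.
Qed.

(** Put the two independent copies at u - v and u + v.  The product of their
    weights is the exponential of a sum of the kernels of
    psd_mult_zcos_add, so the whole summand is a multiplier, and it is tested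
    against the constant function 1. *)
Lemma cov_weight_ge0 s (F H : G -> R) :
  psd_mult (fun u v => F (u - v) - F (u + v)) ->
  psd_mult (fun u v => H (u - v) - H (u + v)) ->
  0 <= cov (weight s) F H.
Proof.
move=> FM HM; have W0 := sum_weight_gt0 s.
rewrite -(pmulr_lge0 _ (x := 2 * (\sum_y weight s y) ^+ 2)); last first.
  by rewrite mulr_gt0// exprn_gt0.
rewrite cov_pairs// sum_rotate.
have KM : psd_mult (fun u v => weight s (u - v) * weight s (u + v) *
    ((F (u - v) - F (u + v)) * (H (u - v) - H (u + v)))).
  apply: psd_multM; last exact: psd_multM.
  have EM := psd_mult_expR (psd_mult_sum s psd_mult_zcos_add).
  by apply: eq_psd_mult EM => u v; rewrite big_split/= expRD.
have := psd_mult_psd KM (fun=> 1); congr (_ <= _).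
by apply: eq_bigr => u _; apply: eq_bigr => v _; rewrite !mulr1.
Qed.

Lemma ginibre s a r : 0 <= cov (weight s) (cos_char a) (cos_char r).
Proof. by apply: cov_weight_ge0; exact: psd_mult_zcos_sub. Qed.

(** The excess is the covariance of cos_a with exp (cos_r) - cos_r, a power
    series in cos_r with nonnegative coefficients. *)
Lemma ginibre_expR s a r :
  cov (weight s) (cos_char a) (cos_char r) <=
  cov (weight s) (cos_char a) (fun y => expR (cos_char r y)).
Proof.
rewrite -subr_ge0 -covBr; apply: cov_weight_ge0; first exact: psd_mult_zcos_sub.
by apply: psd_mult_subexpR; [exact: psd_mult_zcos_add|exact: psd_mult_zcos_sub].
Qed.

Lemma avg_weight_cons r s F :
  avg (weight (r :: s)) F - avg (weight s) F =
  cov (weight s) F (fun y => expR (cos_char r y)) /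
    avg (weight s) (fun y => expR (cos_char r y)).
Proof.
have W0 : \sum_y weight s y != 0 by rewrite gt_eqF ?sum_weight_gt0.
have W1 : \sum_y weight s y * expR (cos_char r y) != 0.
  rewrite (eq_bigr (weight (r :: s))) ?gt_eqF ?sum_weight_gt0// => y _.
  by rewrite weight_cons mulrC.
rewrite /cov /avg.
have -> : \sum_y weight (r :: s) y = \sum_y weight s y * expR (cos_char r y).
  by apply: eq_bigr => y _; rewrite weight_cons mulrC.
have -> : \sum_y weight (r :: s) y * F y = \sum_y weight s y * (F y * expR (cos_char r y)).
  by apply: eq_bigr => y _; rewrite weight_cons; ring.
by field; rewrite W0 W1.
Qed.

(** Tilting the measure by exp (cos_r) moves the mean of cos_a by
    Cov(cos_a, exp (cos_r)) / E(exp (cos_r)), and the denominator is at most e. *)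
Lemma avg_weight_cons_ge r s a :
  cov (weight s) (cos_char a) (cos_char r) / expR 1 <=
  avg (weight (r :: s)) (cos_char a) - avg (weight s) (cos_char a).
Proof.
rewrite avg_weight_cons.
apply: (@le_trans _ _ (cov (weight s) (cos_char a) (fun y => expR (cos_char r y)) / expR 1)).
  by rewrite ler_pM2r ?invr_gt0 ?expR_gt0// ginibre_expR.
apply: ler_wpM2l; first exact: le_trans (ginibre s a r) (ginibre_expR s a r).
have w0 := sum_weight_gt0 s; have wy0 y := ltW (weight_gt0 s y).
have e0 : 0 < avg (weight s) (fun y => expR (cos_char r y)).
  apply: (@lt_le_trans _ _ (expR (-1))); first exact: expR_gt0.
  rewrite -(avg_cst w0 (expR (-1))); apply: le_avg => // y.
  by rewrite ler_expR zcos_geN1.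
rewrite lef_pV2 ?posrE ?expR_gt0// -[leRHS](avg_cst w0 (expR 1)).
by apply: le_avg => // y; rewrite ler_expR zcos_le1.
Qed.

Variable m : G -> R.
Hypothesis m_ge0 : forall r, 0 <= m r.
Notation M := (\sum_r m r).

(** For each r the sum is the first-order gain in the potential of
    exists_saturated when the measure is tilted by exp (cos_r). *)
Definition saturated (kappa : R) (s : seq G) :=
  forall r, \sum_a m a * cov (weight s) (cos_char a) (cos_char r) <= kappa.

(** As long as the list is not saturated, some frequency increases the bounded
    potential Phi by a fixed amount. *)
Lemma exists_saturated kappa (n : nat) :
  2 * M < kappa / expR 1 * n%:R ->
  exists2 s : seq G, (size s <= n)%N & saturated kappa s.
Proof.
pose Phi s := \sum_a m a * avg (weight s) (cos_char a).
have normPhi s : `|Phi s| <= M.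
  apply: le_trans (ler_norm_sum _ _ _) _; apply: ler_sum => a _.
  rewrite normrM ger0_norm// -[leRHS]mulr1 ler_wpM2l//.
  apply: norm_avg_le1 => [|y|y]; first exact: sum_weight_gt0.
    exact: ltW (weight_gt0 s y).
  exact: zcos_max.
have step s r : kappa < \sum_a m a * cov (weight s) (cos_char a) (cos_char r) ->
    Phi s + kappa / expR 1 <= Phi (r :: s).
  move=> kap; rewrite addrC -lerBrDr /Phi -sumrB.
  apply: (@le_trans _ _ ((\sum_a m a * cov (weight s) (cos_char a) (cos_char r)) / expR 1)).
    by rewrite ler_pM2r ?invr_gt0 ?expR_gt0// ltW.
  rewrite mulr_suml; apply: ler_sum => a _.
  by rewrite -mulrBr -mulrA ler_wpM2l// avg_weight_cons_ge.
move=> nbig.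
have : forall k : nat, (exists2 s : seq G, (size s <= k)%N & saturated kappa s) \/
    (exists2 s : seq G, size s = k & - M + kappa / expR 1 * k%:R <= Phi s).
  elim=> [|k [[s sk sat]|[s sk Phis]]].
  - right; exists [::] => //; rewrite mulr0 addr0.
    by have := normPhi [::]; rewrite ler_norml => /andP[].
  - by left; exists s => //; exact: leqW.
  - have [sat|/existsNP[r /negP]] := pselect (saturated kappa s).
      by left; exists s => //; rewrite sk.
    rewrite -ltNge => /step Phir; right; exists (r :: s); first by rewrite /= sk.
    by apply: le_trans Phir; rewrite -natr1; lra.
move=> /(_ n)[//|[s _ Phis]].
by have := normPhi s; rewrite ler_norml => /andP[_]; lra.
Qed.

(** The covariance is bilinear in the coefficients q, and Ginibre's inequality
    lets each absolute value |Cov(cos_a, cos_r)| be replaced by the covariance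
    itself, so that saturation applies. *)
Lemma saturated_cov kappa s (q : G -> R) :
  saturated kappa s -> (forall r, `|q r| <= m r) ->
  cov (weight s) (fun y => \sum_r q r * cos_char r y)
                 (fun y => \sum_r q r * cos_char r y) <= M * kappa.
Proof.
move=> sat qm; rewrite cov_sumr mulr_suml; apply: ler_sum => r _.
rewrite covC cov_sumr.
apply: le_trans (ler_norm _) _; rewrite normrM.
apply: ler_pM => //; apply: le_trans (sat r).
apply: le_trans (ler_norm_sum _ _ _) _; apply: ler_sum => a _.
by rewrite covC normrM (ger0_norm (ginibre _ _ _)) ler_wpM2r// ginibre.
Qed.

End Ginibre.

(** * Almost periods and Fourier inversion *)

Section Translates.
Variables (R : realType) (p : nat).
Notation G := 'Z_p.
Notation N := (Zp_trunc p).+2.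

(** Pigeonhole: cut [-1, 1] into cells of length 2/n and record the cells of
    cos (r x) and sin (r x) for all r in s.  The difference of two points with the
    same record is an almost period, by the addition formula; recording the sine
    as well makes this a purely algebraic fact. *)
Lemma exists_almost_period (s : seq G) (n : nat) :
  (0 < n)%N -> (n.+1 ^ (2 * size s) < N)%N ->
  exists2 t : G, t != 0 & forall r, r \in s -> forall z,
    `|cos_char R r (z + t) - cos_char R r z| <= 4 / n%:R.
Proof.
move=> n0 nN; have n0R : 0 < n%:R :> R by rewrite ltr0n.
have n2 : 0 < 2 / n%:R :> R by rewrite divr_gt0.
pose scaled (x : R) := (x + 1) * (n%:R / 2).
(* The extra cell, with index n, is hit by x = 1 only. *)
pose cell (x : R) : 'I_n.+1 := inord (Num.trunc (scaled x)).
have cellP x y : `|x| <= 1 -> `|y| <= 1 -> cell x = cell y -> `|x - y| <= 2 / n%:R.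
  rewrite !ler_norml => /andP[x1 x2] /andP[y1 y2].
  have pos u : -1 <= u -> 0 <= scaled u.
    by move=> u1; rewrite mulr_ge0 ?divr_ge0 ?ler0n// -lerBlDr sub0r.
  have small u : u <= 1 -> (Num.trunc (scaled u) < n.+1)%N.
    by move=> u2; rewrite ltnS truncn_le_nat -natr1 /scaled; nra.
  move=> /(congr1 val) /=; rewrite !inordK ?small// => xy.
  have := truncn_itv (pos _ x1); have := truncn_itv (pos _ y1).
  rewrite xy -natr1 => /andP[a1 a2] /andP[b1 b2].
  have -> : x - y = (scaled x - scaled y) * (2 / n%:R).
    by rewrite /scaled; field; rewrite gt_eqF.
  by apply/andP; split; nra.
pose code (x : G) : {ffun 'I_(size s) -> 'I_n.+1 * 'I_n.+1} :=
  [ffun i : 'I_(size s) => (cell (zcos R (nth 0 s i * x)), cell (zsin R (nth 0 s i * x)))].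
have : ~~ injectiveb code.
  apply/negP => /injectiveP /leq_card; rewrite card_ffun card_prod !card_ord.
  by rewrite mulnn -expnM leqNgt nN.
move=> /injectivePn[x [y xy codexy]]; exists (x - y); first by rewrite subr_eq0.
move=> _ /(nthP 0)[i si <-] z; set r := nth 0 s i.
have := congr1 (fun g : {ffun 'I_(size s) -> _} => g (Ordinal si)) codexy.
rewrite !ffunE /= -/r => -[cosE sinE].
have dcos : `|zcos R (r * x) - zcos R (r * y)| <= 2 / n%:R.
  by apply: cellP => //; exact: zcos_max.
have dsin : `|zsin R (r * x) - zsin R (r * y)| <= 2 / n%:R.
  by apply: cellP => //; exact: zsin_max.
rewrite /cos_char.
have -> : r * (z + (x - y)) = r * (z - y) + r * x by ring.
have -> : r * z = r * (z - y) + r * y by ring.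
rewrite !zcosD.
set a := zcos R (r * (z - y)); set b := zsin R (r * (z - y)).
have -> : a * zcos R (r * x) - b * zsin R (r * x) -
    (a * zcos R (r * y) - b * zsin R (r * y)) =
    a * (zcos R (r * x) - zcos R (r * y)) - b * (zsin R (r * x) - zsin R (r * y)).
  by ring.
apply: le_trans (ler_normB _ _) _; rewrite !normrM.
have -> : 4 / n%:R = 1 * (2 / n%:R) + 1 * (2 / n%:R) :> R by lra.
by apply: lerD; apply: ler_pM => //; [exact: zcos_max|exact: zsin_max].
Qed.

Lemma weight_shift (s : seq G) (t : G) (d : R) :
  (forall r, r \in s -> forall z, `|cos_char R r (z + t) - cos_char R r z| <= d) ->
  forall y, (1 - (size s)%:R * d) * weight R s y <= weight R s (y + t).
Proof.
move=> td y; have sum_le : \sum_(r <- s) cos_char R r y - (size s)%:R * d <=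
    \sum_(r <- s) cos_char R r (y + t).
  elim: s td => [|r s IH] td; first by rewrite !big_nil mul0r subr0.
  rewrite !big_cons /= -natr1.
  have := td r (mem_head _ _) y; rewrite ler_norml => /andP[h _].
  have {}IH : _ := IH (fun a as_ => td a (mem_behead (s := r :: s) as_)).
  by move: h IH; lra.
apply: (@le_trans _ _ (expR (- ((size s)%:R * d)) * weight R s y)).
  rewrite ler_pM2r ?weight_gt0//.
  exact: expR_ge1Dx.
by rewrite /weight -expRD ler_expR addrC.
Qed.

Lemma weightN (s : seq G) y : weight R s (- y) = weight R s y.
Proof.
by rewrite /weight; congr expR; apply: eq_bigr => r _; rewrite /cos_char mulrN zcosN.
Qed.

Lemma avg_shift_ge (s : seq G) (t : G) (d : R) (f : G -> R) x :
  (forall r, r \in s -> forall z, `|cos_char R r (z + t) - cos_char R r z| <= d) ->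
  (forall y, 0 <= f y <= 1) -> 0 <= d ->
  avg (weight R s) (fun y => f (x + y)) - (size s)%:R * d <=
  avg (weight R s) (fun y => f (x - t + y)).
Proof.
move=> td f01 d0; set v := avg _ _; have W0 := sum_weight_gt0 R s.
have v1 : v <= 1.
  rewrite /v -[leRHS](avg_cst W0 1); apply: le_avg => // y.
    exact: ltW (weight_gt0 _ _ _).
  by have /andP[] := f01 (x + y).
apply: (@le_trans _ _ ((1 - (size s)%:R * d) * v)).
  have : 0 <= (size s)%:R * d * (1 - v) by rewrite !mulr_ge0 ?subr_ge0.
  by nra.
rewrite /v /avg mulrA ler_pM2r ?invr_gt0//.
rewrite [leRHS](reindex_inj (addIr t))/= mulr_sumr.
apply: ler_sum => y _; rewrite mulrA.
have -> : x - t + (y + t) = x + y by ring.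
apply: ler_wpM2r; first by have /andP[] := f01 (x + y).
exact: weight_shift.
Qed.

Lemma norm_avg_shift (s : seq G) (t : G) (d : R) (f : G -> R) x :
  (forall r, r \in s -> forall z, `|cos_char R r (z + t) - cos_char R r z| <= d) ->
  (forall y, 0 <= f y <= 1) -> 0 <= d ->
  `|avg (weight R s) (fun y => f (x + t + y)) -
    avg (weight R s) (fun y => f (x + y))| <= (size s)%:R * d.
Proof.
move=> td f01 d0; rewrite ler_norml.
have := avg_shift_ge (x + t) td f01 d0; rewrite addrK => h1.
have tdN r : r \in s -> forall z, `|cos_char R r (z + - t) - cos_char R r z| <= d.
  by move=> rs z; have := td r rs (z - t); rewrite subrK distrC.
have := avg_shift_ge x tdN f01 d0; rewrite opprK => h2.
by apply/andP; split; lra.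
Qed.

(** Fourier inversion, in the form that uses cosines only. *)
Lemma cos_inversion (f : G -> R) x y :
  \sum_r (N%:R^-1 * \sum_z f z * zcos R (r * (z - x))) * cos_char R r y =
  (f (x + y) + f (x - y)) / 2.
Proof.
have N0 : N%:R != 0 :> R by rewrite pnatr_eq0.
transitivity (\sum_z N%:R^-1 / 2 * f z *
    ((N * (z - x - y == 0%R))%:R + (N * (z - x + y == 0%R))%:R)).
  under [RHS]eq_bigr do rewrite -!sum_zcos -big_split/= mulr_sumr.
  rewrite [RHS]exchange_big/=; apply: eq_bigr => r _.
  rewrite mulr_sumr mulr_suml; apply: eq_bigr => z _.
  rewrite /cos_char (mulrBr r (z - x)) (mulrDr r (z - x)) zcosB zcosD.
  by move: N0; move: (N%:R : R) => n n0; field.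
rewrite (eq_bigr (fun z => (if z == x + y then f z / 2 else 0) +
                           (if z == x - y then f z / 2 else 0))).
  by rewrite big_split/= -!big_mkcond/= !big_pred1_eq; ring.
move=> z _; rewrite !natrM.
have -> : (z - x - y == 0) = (z == x + y) by rewrite -addrA -opprD subr_eq0.
have -> : (z - x + y == 0) = (z == x - y) by rewrite -[RHS]subr_eq0 opprB addrA addrAC.
move: N0; move: (N%:R : R) => n n0.
by do 2!case: ifP => _ /=; field.
Qed.

End Translates.

(** * A saturated list forces extreme density *)

Section Dichotomy.
Variables (R : realType) (p : nat).
Notation G := 'Z_p.
Notation N := (Zp_trunc p).+2.
Hypotheses (p_prime : prime p) (p_ge3 : (3 <= p)%N).

Lemma unit2_Zp : (2%:R : G) \is a GRing.unit.
Proof.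
rewrite unitZpE; last exact: ltnW.
rewrite prime_coprime//; apply/negP => /dvdn_leq; lia.
Qed.

Lemma double_Zp_inj : injective (fun x : G => x + x).
Proof. by move=> x y; rewrite -!mulr2n -(mulr_natl x) -(mulr_natl y) => /(mulrI unit2_Zp). Qed.

Lemma Zp_multiple (t x : G) : t != 0 -> exists k : nat, x = t *+ k.
Proof.
move=> t0; have tU : t \is a GRing.unit.
  rewrite -(natr_Zp t) unitZpE; last exact: ltnW.
  rewrite prime_coprime//; apply/negP => /dvdn_leq.
  have tp : (t < p)%N by rewrite -[X in (_ < X)%N]Zp_cast ?ltn_ord// ltnW.
  by rewrite lt0n leqNgt tp => /(_ t0).
by exists (val (t^-1 * x)); rewrite -mulr_natr natr_Zp mulrA mulrV ?mul1r.
Qed.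

(** With y = (u - v) / 2 this is the quadratic form of the kernel
    (u, v) |-> weight s ((u - v) / 2), which is positive semidefinite. *)
Lemma sum_weight_reflect_ge0 (s : seq G) (g : G -> R) :
  0 <= \sum_y weight R s y * \sum_x g (x + y) * g (x - y).
Proof.
pose h (x : G) := x * 2%:R^-1.
have := psd_weightB s h g; congr (_ <= _).
rewrite exchange_big/= sum_rotate; last exact: double_Zp_inj.
rewrite exchange_big/=; apply: eq_bigr => y _; rewrite mulr_sumr.
apply: eq_bigr => x _.
have -> : h (x + y) - h (x - y) = y.
  rewrite /h -mulrBl; have -> : x + y - (x - y) = y * 2%:R by ring.
  by rewrite mulrK ?unit2_Zp.
by [].
Qed.

Variable A : {set G}.
Definition ind (x : G) : R := (x \in A)%:R.
Definition density : R := #|A|%:R / N%:R.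

Lemma ind01 x : 0 <= ind x <= 1.
Proof. by rewrite /ind; case: (x \in A); rewrite !lexx ler01. Qed.

Lemma sum_ind : \sum_x ind x = N%:R * density.
Proof.
rewrite /ind -natr_sum -big_mkcond sum1_card /density.
by rewrite mulrCA divff ?mulr1// pnatr_eq0.
Qed.

Variable s : seq G.
Notation E := (avg (weight R s)).
Let v x := E (fun y => ind (x + y)).
Let h x y := (ind (x + y) + ind (x - y)) / 2.
Let W0 : 0 < \sum_y weight R s y := sum_weight_gt0 R s.
Let w0 y : 0 <= weight R s y := ltW (weight_gt0 R s y).

Let sum_shift (y : G) (F : G -> R) : \sum_x F (x + y) = \sum_x F x.
Proof. by rewrite [RHS](reindex_inj (addIr y)). Qed.

Lemma avg_sym_ind x : E (h x) = v x.
Proof.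
have vN : E (fun y => ind (x - y)) = v x.
  rewrite /v /avg; congr (_ / _); rewrite (reindex_inj (@oppr_inj G)).
  by apply: eq_bigr => y _; rewrite weightN opprK.
rewrite (eq_avg _ (H := fun y => 2^-1 * (ind (x + y) - (-1) * ind (x - y)))).
  by rewrite avgZ avgB avgZ vN -/(v x); field.
by move=> y; rewrite /h; field.
Qed.

Lemma var_sym_ind x : cov (weight R s) (h x) (h x) = E (fun y => (h x y - v x) ^+ 2).
Proof.
rewrite /cov avg_sym_ind.
rewrite [RHS](eq_avg _ (H := fun y => h x y * h x y - (2 * v x * h x y - v x ^+ 2))).
  by rewrite !avgB avgZ avg_cst// avg_sym_ind; ring.
by move=> y; ring.
Qed.

(** The symmetrised indicator takes the values 0, 1/2 and 1 only, so its variance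
    is at least the squared distance from its mean to these values. *)
Lemma near_half_integer x : exists j : 'I_3,
  (v x - j%:R / 2) ^+ 2 <= cov (weight R s) (h x) (h x).
Proof.
rewrite var_sym_ind.
have [j _ jmin] := @arg_minP _ _ 'I_3 ord0 predT
  (fun j : 'I_3 => (v x - j%:R / 2) ^+ 2) isT.
exists j; rewrite -[leLHS](avg_cst W0); apply: le_avg => // y.
have hj k : (k < 3)%N -> h x y = k%:R / 2 ->
    (v x - j%:R / 2) ^+ 2 <= (h x y - v x) ^+ 2.
  move=> k3 ->; rewrite -[leRHS]sqrrN opprB.
  exact: jmin (Ordinal k3) isT.
rewrite /h /ind in hj *; move: hj.
case: (x + y \in A); case: (x - y \in A) => hj.
- by apply: (hj 2%N) => //; rewrite -natrD.
- by apply: (hj 1%N) => //; rewrite addr0.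
- by apply: (hj 1%N) => //; rewrite add0r.
- by apply: (hj 0%N) => //; rewrite addr0.
Qed.

Lemma sum_local_density : \sum_x v x = N%:R * density.
Proof.
rewrite /v -avg_sum (eq_avg _ (H := fun=> N%:R * density)) ?avg_cst// => y.
by rewrite (sum_shift y) sum_ind.
Qed.

(** Expanding the square of h_x produces the average of ind (x + y) * ind (x - y).
    Applying sum_weight_reflect_ge0 to ind - density bounds it below by the
    square of the density. *)
Lemma sum_var_ge :
  N%:R * (density + density ^+ 2) / 2 - \sum_x v x ^+ 2 <=
  \sum_x cov (weight R s) (h x) (h x).
Proof.
set a := density.
have -> : \sum_x cov (weight R s) (h x) (h x) =
    E (fun y => \sum_x h x y ^+ 2) - \sum_x v x ^+ 2.
  rewrite avg_sum -sumrB; apply: eq_bigr => x _.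
  by rewrite /cov avg_sym_ind -expr2.
rewrite lerD2r; set Q := fun y => \sum_x ind (x + y) * ind (x - y).
rewrite (eq_avg _ (H := fun y => 2^-1 * (N%:R * a - (-1) * Q y))); last first.
  move=> y; rewrite /Q.
  have indK z : ind z ^+ 2 = ind z.
    by rewrite /ind; case: (_ \in A); rewrite ?expr1n ?expr0n.
  rewrite (eq_bigr (fun x => 4^-1 * ind (x + y) + 4^-1 * ind (x - y) +
                      2^-1 * (ind (x + y) * ind (x - y)))).
    rewrite !big_split/= -!mulr_sumr (sum_shift y) (sum_shift (- y)) sum_ind -/a.
    by field.
  move=> x _; rewrite /h; have := indK (x + y); have := indK (x - y).
  by move: (ind (x + y)) (ind (x - y)) => a1 a2; lra.
rewrite avgZ avgB avg_cst// avgZ.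
suff : N%:R * a ^+ 2 <= E Q by lra.
have := sum_weight_reflect_ge0 s (fun x => ind x - a).
rewrite (eq_bigr (fun y => weight R s y * (Q y - N%:R * a ^+ 2))); last first.
  move=> y _; congr (_ * _); rewrite /Q.
  rewrite (eq_bigr (fun x => ind (x + y) * ind (x - y) - a * ind (x + y)
     - a * ind (x - y) + a ^+ 2)); last by move=> x _; ring.
  rewrite big_split/= !sumrB sumr_const card_ord -[a ^+ 2 *+ _]mulr_natl -!mulr_sumr.
  by rewrite (sum_shift y) (sum_shift (- y)) sum_ind -/a; ring.
move=> QE; have : 0 <= E (fun y => Q y - N%:R * a ^+ 2).
  by rewrite /avg divr_ge0// ltW.
by rewrite avgB avg_cst// subr_ge0.
Qed.

(** All local densities v x lie near half-integers and v moves by at most 1/8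
    along the almost period t, so all of them are near the same half-integer b.
    Then the mean square of v cannot exceed the square of its mean by more than
    e2, whereas by sum_var_ge it exceeds it by about half of
    density * (1 - density) if the variances are small. *)
Lemma density_saturated (n : nat) (e2 : R) :
  (0 < n)%N -> (n.+1 ^ (2 * size s) < p)%N ->
  (size s)%:R * (4 / n%:R) <= 8^-1 :> R -> e2 <= 36^-1 ->
  (forall x, cov (weight R s) (h x) (h x) <= e2) ->
  density * (1 - density) <= 4 * e2.
Proof.
move=> n0 nN sn e2small hcov.
have [t t0 tper] : exists2 t : G, t != 0 & forall r, r \in s -> forall z,
    `|cos_char R r (z + t) - cos_char R r z| <= 4 / n%:R.
  by apply: exists_almost_period => //; rewrite [X in (_ < X)%N]Zp_cast// ltnW.
have sixth x : x ^+ 2 <= e2 -> `|x| <= 6^-1.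
  move=> xe; rewrite -(@ler_pXn2r _ 2) ?nnegrE ?invr_ge0// real_normK ?num_real//.
  by apply: le_trans xe _; lra.
have [j0 j0P] := near_half_integer 0.
(* Two half-integers within 1/6 + 1/8 + 1/6 < 1/2 of each other coincide. *)
have walk k : (v (t *+ k) - j0%:R / 2) ^+ 2 <= e2.
  elim: k => [|k IH]; first by apply: le_trans j0P _.
  have [j jP] := near_half_integer (t *+ k.+1).
  have {}jP := le_trans jP (hcov _).
  suff -> : j0 = j by [].
  have step : `|v (t *+ k.+1) - v (t *+ k)| <= 8^-1.
    rewrite mulrSr; apply: le_trans sn; apply: norm_avg_shift => // => x; exact: ind01.
  have := sixth _ IH; have := sixth _ jP; move: step; rewrite !ler_norml.
  move=> /andP[s1 s2] /andP[a1 a2] /andP[b1 b2].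
  apply/val_inj/eqP; rewrite eqn_leq -(ltnS j0 j) -(ltnS j j0) -!(ltr_nat R) -!natr1.
  by apply/andP; split; lra.
have vnear x : (v x - j0%:R / 2) ^+ 2 <= e2.
  by have [k ->] := Zp_multiple x t0.
have : \sum_(x : G) (v x - j0%:R / 2) ^+ 2 <= N%:R * e2.
  apply: le_trans (ler_sum _ (fun x _ => vnear x)) _.
  by rewrite sumr_const card_ord mulr_natl.
have : \sum_x cov (weight R s) (h x) (h x) <= N%:R * e2.
  apply: le_trans (ler_sum _ (fun x _ => hcov x)) _.
  by rewrite sumr_const card_ord mulr_natl.
have := sum_var_ge; set V := \sum_x v x ^+ 2; set a := density; set b := j0%:R / 2.
have -> : \sum_x (v x - b) ^+ 2 = V - 2 * b * (N%:R * a) + N%:R * b ^+ 2.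
  rewrite (eq_bigr (fun x => v x ^+ 2 - 2 * b * v x + b ^+ 2)); last by move=> x _; ring.
  rewrite big_split/= sumrB sumr_const card_ord -[b ^+ 2 *+ _]mulr_natl.
  by rewrite -mulr_sumr sum_local_density.
move=> h1 h2 h3.
have Npos : 0 < N%:R :> R by rewrite ltr0n.
rewrite -(ler_pM2l Npos); move: (N%:R : R) Npos h1 h2 h3 => q qpos h1 h2 h3.
(* The mean minimises the mean square deviation. *)
have : 0 <= q * (a - b) ^+ 2 by rewrite mulr_ge0 ?sqr_ge0 ?ltW.
by nra.
Qed.

End Dichotomy.

(** * Two numerical facts *)

(** This makes ln (ln 3) positive, so that ln (ln p) is bounded away from 0 for all
    p >= 3. *)
Lemma expR1_lt3 (R : realType) : expR 1 < 3 :> R.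
Proof.
(* e^-1 = (e^(-1/6))^6 >= (5/6)^6 > 1/3. *)
have e6 : expR (-1) = expR (- 6^-1) ^+ 6 :> R.
  by rewrite -expRM_natl; congr expR; lra.
have : (5 / 6) ^+ 6 <= expR (-1) :> R.
  rewrite e6; apply: lerXn2r; rewrite ?nnegrE ?expR_ge0//.
  by apply: le_trans (expR_ge1Dx _); lra.
rewrite expRN => h; have e0 := expR_gt0 (1 : R).
have : 3^-1 < (expR 1)^-1 :> R by apply: lt_le_trans h; lra.
by rewrite ltf_pV2 ?posrE.
Qed.

(** Apart from the range ln L < 1, where L / (ln L)^3 is bounded and M >= c
    suffices, either M^2 >= L or the logarithm on the right is
    O(ln L), which gives M^2 >= L / ln L up to a constant. *)
Lemma log_bound_inversion (R : realType) (c K L0 : R) : 0 < c -> 0 < K -> 1 < L0 ->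
  exists C : R, 0 < C /\ forall L M : R, L0 <= L -> c <= M ->
    L <= 2 * (K * M ^+ 2) * ln (33 * (K * M ^+ 2)) ->
    C * (L / ln L ^+ 3) `^ (1 / 2) <= M.
Proof.
move=> c0 K0 L01; have l0 : 0 < ln L0 by rewrite ln_gt0.
pose b : R := `|ln (33 * K)| + 1; have b0 : 0 < b by rewrite ltr_pwDr.
pose X0 := expR 1 / ln L0 ^+ 3.
have X00 : 0 < X0 by rewrite divr_gt0 ?expR_gt0 ?exprn_gt0.
pose D := Num.min 1 (Num.min (2 * K * b)^-1 (c ^+ 2 / X0)).
have D0 : 0 < D.
  rewrite !lt_min ltr01 /= invr_gt0; apply/andP; split.
    by rewrite !mulr_gt0.
  by apply: divr_gt0 => //; rewrite exprn_gt0.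
exists (Num.sqrt D); split; first by rewrite sqrtr_gt0.
move=> L M L0L cM LM; have M0 : 0 < M := lt_le_trans c0 cM.
have L1 : 1 < L := lt_le_trans L01 L0L; have Lp : 0 < L := lt_trans ltr01 L1.
set l := ln L; have lp : 0 < l by rewrite ln_gt0.
have l0l : ln L0 <= l by rewrite ler_ln ?posrE// (lt_trans ltr01).
have X_ge0 : 0 <= L / l ^+ 3 by rewrite divr_ge0 ?exprn_ge0// ltW.
rewrite div1r powR12_sqrt// -sqrtrM ?(ltW D0)// -(ger0_norm (ltW M0)) -sqrtr_sqr.
rewrite ler_wsqrtr//.
have M20 : 0 < M ^+ 2 by rewrite exprn_gt0.
have [l1|l1] := leP 1 l; last first.
  have XX0 : L / l ^+ 3 <= X0.
    apply: ler_pM; rewrite ?invr_ge0 ?exprn_ge0 ?(ltW Lp) ?(ltW lp)//.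
      by rewrite -(lnK (x := L)) ?posrE// ler_expR ltW.
    by rewrite lef_pV2 ?posrE ?exprn_gt0// lerXn2r ?nnegrE ?(ltW l0) ?(ltW lp).
  apply: (@le_trans _ _ (c ^+ 2 / X0 * X0)).
    by apply: ler_pM => //; rewrite ?(ltW D0)// !ge_min lexx !orbT.
  rewrite divfK ?gt_eqF// lerXn2r ?nnegrE ?(ltW c0) ?(ltW M0)//.
have Xl : L / l ^+ 3 <= L / l.
  by rewrite ler_pM2l// lef_pV2 ?posrE ?exprn_gt0// ler_eXnr.
have [LM2|M2L] := leP L (M ^+ 2).
  apply: le_trans LM2; apply: (@le_trans _ _ (1 * (L / l))).
    by apply: ler_pM => //; rewrite ?(ltW D0)// ge_min lexx.
  by rewrite mul1r ler_pdivrMr// ler_peMr// ltW.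
have lnle : ln (33 * (K * M ^+ 2)) <= b * l.
  apply: (@le_trans _ _ (ln (33 * K * L))).
    by rewrite ler_ln ?posrE ?mulr_gt0// mulrA ler_pM2l ?mulr_gt0// ltW.
  rewrite lnM ?posrE ?mulr_gt0// -/l /b (mulrDl _ 1) mul1r lerD2r.
  apply: le_trans (ler_norm _) _; rewrite ler_peMr//.
have {LM lnle} LM : L <= 2 * K * b * M ^+ 2 * l.
  apply: le_trans LM _.
  have -> : 2 * K * b * M ^+ 2 * l = 2 * (K * M ^+ 2) * (b * l) by ring.
  by rewrite ler_pM2l// !mulr_gt0.
apply: (@le_trans _ _ ((2 * K * b)^-1 * (L / l))).
  by apply: ler_pM => //; rewrite ?(ltW D0)// !ge_min lexx !orbT.
by rewrite mulrC ler_pdivrMr ?mulr_gt0// ler_pdivrMr// [M ^+ 2 * _]mulrC.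
Qed.

(** * Spectral norm and conclusion *)

Lemma cabs_ge0 (R : realType) (z : R[i]%C) : 0 <= cabs z.
Proof. by case: z => a b; exact: sqrtr_ge0. Qed.

Lemma Re_sum (R : realType) (I : finType) (F : I -> R[i]%C) :
  complex.Re (\sum_i F i) = \sum_i complex.Re (F i).
Proof. by apply: (big_morph (@complex.Re R)) => // -[a b] [a' b']. Qed.

Lemma Re_realM (R : realType) (a : R) (z : R[i]%C) :
  complex.Re (a%:C%C * z) = a * complex.Re z.
Proof. by case: z => u v /=; rewrite mul0r subr0. Qed.

Section Spectrum.
Variables (R : realType) (p : nat).
Hypotheses (p_prime : prime p) (p_ge3 : (3 <= p)%N).
Notation G := 'Z_p.
Notation N := (Zp_trunc p).+2.
Local Open Scope complex_scope.

Definition zchar (r : G) : G -> R[i] := fun x => zcos R (r * x) +i* zsin R (r * x).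

Lemma zchar_dual r : dual_group R p (zchar r).
Proof.
split=> [x|x y]; rewrite /zchar /=.
  by rewrite zcos2Dzsin2 sqrtr1.
by rewrite mulrDr zcosD zsinD; congr (_ +i* _); ring.
Qed.

Lemma zchar_inj : injective zchar.
Proof.
move=> r r' /(congr1 (fun g => g 1)); rewrite /zchar !mulr1 => -[cosE sinE].
apply/eqP; rewrite -subr_eq0; apply/negPn/negP => /(zcos_neq1 R).
by rewrite zcosB cosE sinE -!expr2 zcos2Dzsin2 eqxx.
Qed.

Variable f : G -> R[i].

(** The explicit characters are pairwise distinct elements of the dual group. *)
Lemma sum_zchar_le_A_norm :
  \sum_r cabs (fourier f (zchar r)) <= A_norm f.
Proof.
have fin := finite_dual_group R p.
have rangeI : dual_group R p `&` range zchar = range zchar.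
  by rewrite setIC; apply/setIidl => _ [r _ <-]; exact: zchar_dual.
rewrite /A_norm (fsbigID (range zchar))//= rangeI fsbig_image; last first.
  by move=> r r' _ _ /zchar_inj.
rewrite [X in X <= _]fsbig_seq ?index_enum_uniq//.
rewrite (_ : [set` _] = [set: G]); last first.
  by apply/seteqP; split=> // r _ /=; exact: mem_index_enum.
rewrite lerDl; apply: fsumr_ge0 => g _; exact: cabs_ge0.
Qed.

(** The left-hand side is the real part of the Fourier coefficient times the
    unimodular number zchar r x. *)
Lemma cos_coef_le (F : G -> R) (r x : G) :
  `|N%:R^-1 * \sum_z F z * zcos R (r * (z - x))| <=
  cabs (fourier (fun z => (F z)%:C) (zchar r)).
Proof.
set w := fourier _ _.
have -> : N%:R^-1 * \sum_z F z * zcos R (r * (z - x)) = complex.Re (w * zchar r x).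
  have -> : w * zchar r x =
      (N%:R^-1 : R)%:C * \sum_z (F z)%:C * ((zchar r z)^* * zchar r x)%C.
    rewrite /w /fourier -mulrA mulr_suml rmorphV ?unitfE ?pnatr_eq0//= rmorph_nat.
    rewrite [in LHS](_ : p%:R = N%:R); last by rewrite [in RHS]Zp_cast// ltnW.
    by congr (_ * _); apply: eq_bigr => z _; rewrite -mulrA.
  rewrite Re_realM Re_sum; congr (_ * _); apply: eq_bigr => z _.
  by rewrite Re_realM /zchar/= mulrBr zcosB; ring.
have <- : cabs (w * zchar r x) = cabs w.
  by rewrite ComplexField.Normc.normcM (zchar_dual r).1 mulr1.
case: (w * zchar r x) => a b /=; rewrite -sqrtr_sqr ler_wsqrtr//.
by rewrite lerDl sqr_ge0.
Qed.

End Spectrum.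

Theorem theorem1p4 (R : realType) (c : R) (hc : 0 < c <= 1 / 2%:R) :
  exists C : R, 0 < C /\
    forall (p : nat) (A : {set 'Z_p}),
      prime p -> (3 <= p)%N ->
      c <= #|A|%:R / p%:R <= 1 - c ->
      C * (ln p%:R / ln (ln p%:R) ^+ 3) `^ (1 / 2%:R) <= A_norm (chi R A).
Proof.
have /andP[c0 c2] := hc; pose e : R := expR 1; have e0 : 0 < e := expR_gt0 1.
have L01 : 1 < ln 3 :> R.
  by rewrite -[ltLHS](expRK (1 : R)) ltr_ln ?posrE ?expR_gt0// expR1_lt3.
(* K absorbs the rounding of the number D of steps, using M >= c. *)
pose K : R := 36 * e / c + (c ^+ 2)^-1.
have K0 : 0 < K by rewrite addr_gt0 ?invr_gt0 ?exprn_gt0// divr_gt0// mulr_gt0.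
have [C [C0 CP]] := log_bound_inversion c0 K0 L01.
exists C; split=> // p A p_prime p_ge3 /andP[cA Ac].
have pN : (Zp_trunc p).+2 = p by rewrite Zp_cast// ltnW.
have dE : density R A = #|A|%:R / p%:R by rewrite /density; congr (_ / _%:R).
pose m r : R := cabs (fourier (chi R A) (zchar R r)).
have m0 r : 0 <= m r by exact: cabs_ge0.
pose M := \sum_r m r.
have MA : M <= A_norm (chi R A) by exact: sum_zchar_le_A_norm.
have coef r x : `|(Zp_trunc p).+2%:R^-1 * \sum_z ind R A z * zcos R (r * (z - x))| <= m r.
  rewrite /m (_ : chi R A = fun z => (ind R A z)%:C%C); first exact: cos_coef_le.
  by apply/funext => z; rewrite /chi /ind rmorph_nat.
have cM : c <= M.
  apply: le_trans cA _; rewrite -dE.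
  have -> : density R A = (Zp_trunc p).+2%:R^-1 * \sum_z ind R A z * zcos R (0 * (z - 0)).
    rewrite (eq_bigr (ind R A)) ?sum_ind; last by move=> z _; rewrite mul0r zcos0 mulr1.
    by rewrite mulKf// pnatr_eq0.
  apply: le_trans (ler_norm _) _; apply: le_trans (coef 0 0) _.
  by rewrite /M (bigD1 (0 : 'Z_p))//= lerDl sumr_ge0.
apply: le_trans MA; have M0 : 0 < M := lt_le_trans c0 cM.
apply: CP => //; first by rewrite ler_ln ?posrE ?ltr0n ?ler_nat// (ltn_trans _ p_ge3).
(* The variance allowed is c/18, so saturation is needed at level c/18/M; a step
   gains at least c/(18 M e) and the potential has range 2 M, whence the
   constant 36 e. *)
pose D := (Num.trunc (36 * e * M ^+ 2 / c)).+1.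
have x0 : 0 <= 36 * e * M ^+ 2 / c.
  by rewrite !mulr_ge0 ?invr_ge0 ?exprn_ge0 ?(ltW e0) ?(ltW c0) ?(ltW M0).
have /andP[D1 D2] := truncn_itv x0.
have DK : D%:R <= K * M ^+ 2.
  rewrite -natr1 /K (mulrDl (36 * e / c)); apply: lerD.
    by apply: le_trans D1 _; rewrite mulrAC.
  by rewrite mulrC ler_pdivlMr ?exprn_gt0// mul1r lerXn2r ?nnegrE ?(ltW c0) ?(ltW M0).
have [s sD sat] : exists2 s : seq 'Z_p, (size s <= D)%N & saturated m (c / 18 / M) s.
  apply: exists_saturated => //; first exact: double_Zp_inj.
  rewrite -/M -/e.
  have -> : c / 18 / M / e * D%:R = 2 * M * (D%:R * (c / (36 * e * M ^+ 2))).
    by field; rewrite !gt_eqF.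
  rewrite ltr_pMr ?mulr_gt0//.
  move: D2; rewrite ltr_pdivrMr// => D2.
  by rewrite mulrA ltr_pdivlMr ?mul1r// !mulr_gt0// exprn_gt0.
(* 32 D cells make the local density move by at most D * 4/(32 D) = 1/8. *)
have pD : (p <= (32 * D).+1 ^ (2 * size s))%N.
  rewrite leqNgt; apply/negP => pbig.
  have := @density_saturated R p p_prime p_ge3 A s (32 * D) (c / 18) isT pbig.
  have step1 : (size s)%:R * (4 / (32 * D)%:R) <= 8^-1 :> R.
    rewrite natrM.
    have Dp : 0 < D%:R :> R by rewrite ltr0n.
    have -> : 4 / (32%:R * D%:R) = 8^-1 / D%:R :> R by field; rewrite gt_eqF.
    by rewrite mulrCA ger_pMr ?invr_gt0// ler_pdivrMr// mul1r ler_nat.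
  have step2 : c / 18 <= 36^-1 by lra.
  move=> /(_ step1 step2) H.
  have {H} : density R A * (1 - density R A) <= 4 * (c / 18).
    apply: H => x.
    have := saturated_cov (double_Zp_inj p_prime p_ge3) sat (fun r => coef r x).
    rewrite -/M mulrC divfK ?gt_eqF//.
    rewrite (_ : (fun y => \sum_r _ * cos_char R r y) =
                 fun y => (ind R A (x + y) + ind R A (x - y)) / 2)//.
    by apply/funext => y; exact: cos_inversion.
  (* But the density a satisfies a (1 - a) >= c (1 - c) >= c/2 > 4 c/18. *)
  rewrite dE; nra.
have p0 : (0 < p)%N := prime_gt0 p_prime.
have DR1 : 1 <= D%:R :> R by rewrite ler1n.
have : ln p%:R <= 2 * D%:R * ln (33 * D%:R) :> R.
  apply: (@le_trans _ _ (ln ((33 * D%:R) ^+ (2 * D)))).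
    rewrite ler_ln ?posrE ?exprn_gt0 ?mulr_gt0 ?ltr0n//.
    apply: (@le_trans _ _ (((32 * D).+1 ^ (2 * D))%:R)).
      by rewrite ler_nat; apply: leq_trans pD _; rewrite leq_pexp2l// leq_mul2l sD orbT.
    rewrite natrX lerXn2r ?nnegrE ?ler0n// ?mulr_ge0//.
    by rewrite -natr1 natrM; lra.
  by rewrite lnXn ?mulr_gt0 ?ltr0n// -[_ *+ (2 * D)]mulr_natl natrM.
move=> h; apply: le_trans h _.
have KM1 : 1 <= K * M ^+ 2 := le_trans DR1 DK.
apply: ler_pM; rewrite ?mulr_ge0 ?ler0n//.
- by apply: ln_ge0; lra.
- by rewrite ler_pM2l.
- by rewrite ler_ln ?posrE ?mulr_gt0 ?ltr0n ?ler_pM2l// (lt_le_trans ltr01).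
Qed.
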